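(* Let $\mathrm{Planar}$ denote the family of all planar graphs. There exists an absolute constant $c>0$ such that for every positive integer $k$, $$f^*(k)\;\ge\; f^*(k,\mathrm{Planar})\;\ge\; c\,k^2 .$$
   Context: All graphs are finite and undirected, with nonnegative edge lengths $\ell:E(G)\to\mathbb{R}_{\ge 0}$; $d_H$ denotes shortest-path distance in a graph $H$ with respect to its edge lengths. Given a graph $G=(V,E,\ell)$ and a set of terminals $R\subseteq V$, a distance-preserving minor of $G$ with respect to $R$ is a graph $G'$ with edge lengths $\ell'$ (which may differ from $\ell$) such that $G'$ is a minor of $G$ in which the terminals survive (terminals are never deleted and no two terminals are merged; a terminal may be merged with non-terminals by edge contraction, and the resulting vertex is identified with that terminal), so $R\subseteq V(G')$, and $d_{G'}(u,v)=d_G(u,v)$ for all $u,v\in R$. For a family $\mathcal{F}$ of graphs (defined irrespective of edge lengths), $f^*(k,\mathcal{F})$ is the minimum number such that every graph in $\mathcal{F}$, with any nonnegative edge lengths and any set of $k$ terminals, admits a distance-preserving minor with at most $f^*(k,\mathcal{F})$ vertices; $f^*(k)$ denotes this quantity for the family of all graphs. *)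

(* Defs.v *)
From Stdlib Require Import Relation_Operators.
From mathcomp Require Import all_boot all_order all_algebra.
From mathcomp Require Import all_classical all_reals all_analysis.

Set Implicit Arguments.
Unset Strict Implicit.
Unset Printing Implicit Defensive.

Import Order.TTheory GRing.Theory Num.Theory.
Import numFieldNormedType.Exports.

Local Open Scope ring_scope.

(* A simple graph: edges are two-element sets of vertices. The vertices form a
   subset of an ambient finite type, so that a graph and those obtained from it
   by deletions and contractions share one type. *)
Record graph (V : finType) := Graph {
  vertices : {set V};
  edges : {set {set V}};
  edges_wf : [forall e in edges, (e \subset vertices) && (#|e| == 2%N)] }.

Definition edge_between (V : finType) (x y : V) : {set V} := [set x; y]%SET.

Definition adj (V : finType) (G : graph V) : rel V :=
  fun x y => edge_between x y \in edges G.

(* Edge lengths are given by a function on all sets of vertices, of which only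
   the values on the edges matter. *)
Definition nonneg_lengths (R : realType) (V : finType) (G : graph V)
    (l : {set V} -> R) : Prop :=
  forall e, e \in edges G -> 0 <= l e.

Definition path_from_to (V : finType) (G : graph V) (x y : V) (p : seq V) : Prop :=
  [/\ path (adj G) x p, uniq (x :: p) & last x p = y].

Definition path_length (R : realType) (V : finType) (l : {set V} -> R)
    (x : V) (p : seq V) : R :=
  \sum_(e <- pairmap (@edge_between V) x p) l e.

(* The infimum ranges over a finite set, hence is a minimum, unless x and y lie
   in different components, in which case it is +oo. *)
Definition dist (R : realType) (V : finType) (G : graph V) (l : {set V} -> R)
    (x y : V) : \bar R :=
  ereal_inf [set (path_length l x p)%:E | p in path_from_to G x y]%classic.

(* Contracting the edge {u, v} into u. *)
Definition merge (V : finType) (u v : V) : V -> V :=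
  fun x => if x == v then u else x.

(* One minor operation, for the set T of terminals. The vertex v that disappears
   is never a terminal: contracting an edge between a terminal and a
   non-terminal keeps the name of the terminal, and an edge between two
   terminals cannot be contracted. In a contraction, parallel edges are
   identified and the edge {u, v}, whose image is {u}, is removed. *)
Inductive minor_step (V : finType) (T : {set V}) (G H : graph V) : Prop :=
| EdgeDeletion (e : {set V}) of
    e \in edges G &
    vertices H = vertices G &
    edges H = (edges G :\ e)%SET
| VertexDeletion (v : V) of
    v \in vertices G & v \notin T &
    vertices H = (vertices G :\ v)%SET &
    edges H = [set e in edges G | v \notin e]%SET
| EdgeContraction (u v : V) of
    adj G u v & v \notin T &
    vertices H = (vertices G :\ v)%SET &
    edges H = ([set merge u v @: (e : {set V}) | e in edges G] :\ [set u])%SET.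

(* [terminal_minor T G H]: H is a minor of G in which the terminals survive. *)
Definition terminal_minor (V : finType) (T : {set V}) (G H : graph V) : Prop :=
  clos_refl_trans (graph V) (minor_step T) G H.

Definition distance_preserving_minor (R : realType) (V : finType)
    (G : graph V) (l : {set V} -> R) (T : {set V})
    (G' : graph V) (l' : {set V} -> R) : Prop :=
  [/\ terminal_minor T G G',
      nonneg_lengths G' l' &
      forall u v, u \in T -> v \in T -> dist G' l' u v = dist G l u v].

Definition graph_family := forall V : finType, graph V -> Prop.

Definition all_graphs : graph_family := fun _ _ => True.

(* A drawing in the plane: vertices are distinct points, every edge is an arc
   joining its two ends, whose interior contains no vertex and no point of the
   interior of another edge. *)
Definition plane_drawing (R : realType) (V : finType) (G : graph V)
    (pos : V -> R * R) (arc : {set V} -> R -> R * R) : Prop :=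
  [/\ {in vertices G &, injective pos},
      forall e, e \in edges G ->
        [/\ {within `[0, 1], continuous (arc e)}%classic,
            {in `[0, 1] &, injective (arc e)} &
            exists x y, [/\ e = edge_between x y, arc e 0 = pos x
                          & arc e 1 = pos y]],
      forall e x t, e \in edges G -> x \in vertices G -> t \in `]0, 1[ ->
        arc e t <> pos x &
      forall e f s t, e \in edges G -> f \in edges G -> e != f ->
        s \in `]0, 1[ -> t \in `]0, 1[ -> arc e s <> arc f t].

Definition planar (R : realType) : graph_family :=
  fun V G => exists (pos : V -> R * R) (arc : {set V} -> R -> R * R),
    plane_drawing G pos arc.

(* [vertices_suffice R F k n]: every graph of F with nonnegative lengths and k
   terminals has a distance-preserving minor with at most n vertices. *)
Definition vertices_suffice (R : realType) (F : graph_family) (k n : nat) : Prop :=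
  forall (V : finType) (G : graph V) (l : {set V} -> R) (T : {set V}),
    F V G -> nonneg_lengths G l -> T \subset vertices G -> #|T| = k ->
    exists (G' : graph V) (l' : {set V} -> R),
      distance_preserving_minor G l T G' l' /\ (#|vertices G'| <= n)%N.

(* The least n such that n vertices suffice, and +oo if there is none. *)
Definition fstar (R : realType) (F : graph_family) (k : nat) : \bar R :=
  ereal_inf [set n%:R%:E | n in vertices_suffice R F k]%classic.

(* Main.v *)
(* The hard instances are square grids with unit lengths in which both ends of
   n = k %/ 4 rows and of n columns are terminals. In a distance-preserving minor
   G', short paths joining the ends of two different rows share no vertex:
   exchanging their ends would yield two paths of the same total length, whereas
   the crosswise distances exceed the straight ones. The same holds for columns.
   On the other hand, the path of a row and the path of a column lift, through
   the branch sets of the minor, to connected sets of the grid that join opposite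
   sides; such sets intersect, so the two paths share a vertex. These n ^ 2 common
   vertices are pairwise distinct. *)

Require Import Defs.
From mathcomp Require Import all_boot all_order all_algebra.
From mathcomp Require Import all_classical all_reals all_analysis.
From mathcomp Require Import zify lra.

Set Implicit Arguments.
Unset Strict Implicit.
Unset Printing Implicit Defensive.

Import Order.TTheory GRing.Theory Num.Theory.
Import numFieldNormedType.Exports.

Local Open Scope ring_scope.

(** * Walks, simple paths and distances *)

Section Walks.
Variables (R : realType) (V : finType).
Implicit Types (G : graph V) (l : {set V} -> R) (x y : V) (p q : seq V).

Lemma path_length_cons l x y p :
  path_length l x (y :: p) = l (edge_between x y) + path_length l y p.
Proof. by rewrite /path_length /= big_cons. Qed.

Lemma path_length_cat l x p q :
  path_length l x (p ++ q) = path_length l x p + path_length l (last x p) q.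
Proof. by rewrite /path_length pairmap_cat big_cat. Qed.

Lemma path_length_ge0 G l x p :
  nonneg_lengths G l -> path (adj G) x p -> 0 <= path_length l x p.
Proof.
move=> l0; elim: p x => [|y p IH] x /=; first by rewrite /path_length big_nil.
by move=> /andP[xy py]; rewrite path_length_cons addr_ge0 ?l0 ?IH.
Qed.

(** Cutting out closed subwalks never lengthens a walk, because lengths are nonnegative. This lets
    arbitrary walks bound [dist], which ranges over simple paths only. *)
Lemma walk_shorten G l x p :
  nonneg_lengths G l -> path (adj G) x p ->
  exists2 q, path_from_to G x (last x p) q & path_length l x q <= path_length l x p.
Proof.
move=> l0; elim: p x => [|y p IH] x /=; first by move=> _; exists [::].
move=> /andP[xy /IH[q [pq uq lq] lenq]].
have [xq|xq] := boolP (x \in y :: q); last first.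
  exists (y :: q); last by rewrite !path_length_cons lerD2l.
  by split => //=; [rewrite xy | rewrite xq].
(* Here [x] recurs on the shortened tail; only the part [q2] after that occurrence is kept. *)
rewrite -lq path_length_cons.
case/splitPl: xq pq uq lq lenq => q1 q2 lq1.
rewrite cat_path last_cat path_length_cat lq1 -cat_cons cat_uniq.
move=> /andP[pq1 pq2] /and3P[_ /hasPn hq uq2] _ len.
exists q2.
  split=> //=; rewrite uq2 andbT; apply/negP => /hq.
  by rewrite -lq1 mem_last.
have := path_length_ge0 l0 pq1.
have := l0 _ xy.
by lra.
Qed.

Lemma dist_le_walk G l x p :
  nonneg_lengths G l -> path (adj G) x p ->
  (dist G l x (last x p) <= (path_length l x p)%:E)%E.
Proof.
move=> l0 /(walk_shorten l0)[q qP len].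
apply: (@le_trans _ _ (path_length l x q)%:E); last by rewrite lee_fin.
by apply: ereal_inf_lbound; exists q.
Qed.

(** Swapping the tails of the two paths at [z] gives walks from [x] to [y'] and from [x'] to [y]
    with the same total length. *)
Lemma dist_exchange G l x y x' y' p p' z :
    nonneg_lengths G l -> path_from_to G x y p -> path_from_to G x' y' p' ->
    z \in x :: p -> z \in x' :: p' ->
  (dist G l x y' + dist G l x' y <= (path_length l x p + path_length l x' p')%:E)%E.
Proof.
move=> l0 [pp _ <-] [pp' _ <-] zp zp'.
case/splitPl: zp pp => p1 p2 lp1; case/splitPl: zp' pp' => p1' p2' lp1'.
rewrite !cat_path !last_cat !path_length_cat lp1 lp1'.
move=> /andP[w1' w2'] /andP[w1 w2].
have d1 : (dist G l x (last z p2') <=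
           (path_length l x p1 + path_length l z p2')%:E)%E.
  have := @dist_le_walk G l x (p1 ++ p2') l0.
  by rewrite cat_path last_cat path_length_cat lp1 w1 w2'; apply.
have d2 : (dist G l x' (last z p2) <=
           (path_length l x' p1' + path_length l z p2)%:E)%E.
  have := @dist_le_walk G l x' (p1' ++ p2) l0.
  by rewrite cat_path last_cat path_length_cat lp1' w1' w2; apply.
apply: (le_trans (leeD d1 d2)); rewrite -EFinD lee_fin; lra.
Qed.

End Walks.

(** * Lifting connectivity from a minor to the original graph *)

Section Minors.
Variables (V : finType) (T : {set V}).
Implicit Types G H : graph V.

Definition adj_in G (S : {set V}) : rel V :=
  fun x y => [&& adj G x y, x \in S & y \in S].

Lemma adj_sym G x y : adj G x y = adj G y x.
Proof. by rewrite /adj /edge_between finset.setUC. Qed.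

Lemma adj_in_sym G S : symmetric (adj_in G S).
Proof. by move=> x y; rewrite /adj_in adj_sym [(x \in S) && _]andbC. Qed.

Lemma edge_subset G e : e \in edges G -> e \subset vertices G.
Proof. by move=> eG; have /forallP/(_ e) := edges_wf G; rewrite eG => /andP[]. Qed.

Lemma card_edge G e : e \in edges G -> #|e| = 2.
Proof.
by move=> eG; have /forallP/(_ e) := edges_wf G; rewrite eG => /andP[_ /eqP].
Qed.

Lemma adj_neq G x y : adj G x y -> x != y.
Proof. by move=> /card_edge; rewrite cards2; case: eqP. Qed.

Lemma adj_vertexr G x y : adj G x y -> y \in vertices G.
Proof. by move=> /edge_subset /fintype.subsetP; apply; rewrite !inE eqxx orbT. Qed.

Lemma path_vertices G x p :
  x \in vertices G -> path (adj G) x p -> {subset x :: p <= vertices G}.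
Proof.
elim: p x => [|y p IH] x xG /=; first by move=> _ z; rewrite inE => /eqP->.
move=> /andP[/adj_vertexr yG py] z; rewrite inE => /predU1P[->//|].
exact: IH.
Qed.

Lemma minor_terminals G H :
  terminal_minor T G H -> T \subset vertices G -> T \subset vertices H.
Proof.
elim=> [{}G {}H|//|{}G H' {}H _ IH1 _ IH2 /IH1 /IH2//].
case=> [e _ -> //|v _ vT -> _|u v _ vT -> _] TG; apply/fintype.subsetP => t tT;
  rewrite !inE (fintype.subsetP TG) // andbT; by apply: contraNneq vT => <-.
Qed.

(* The fibres of [f] are the branch sets of the minor. A deleted vertex, or one
   contracted into a vertex deleted later, is in the fibre of a vertex outside H. *)
Lemma minor_lift G H : terminal_minor T G H ->
  exists f : V -> V, {in T, f =1 id} /\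
    forall (S : {set V}) x y, adj_in H S x y ->
      connect (adj_in G (f @^-1: S)) x y.
Proof.
elim=> [{}G {}H|{}G|{}G H' {}H _ [f [fT fS]] _ [g [gT gS]]].
- case=> [e _ _ EH|v _ _ _ EH|u v uv vT _ EH].
  + exists id; split=> // S x y /and3P[xy xS yS]; apply: connect1.
    move: xy; rewrite /adj EH !inE => /andP[_ xy].
    by apply/and3P; rewrite !inE.
  + exists id; split=> // S x y /and3P[xy xS yS]; apply: connect1.
    move: xy; rewrite /adj EH !inE => /andP[xy _].
    by apply/and3P; rewrite !inE.
  + exists (Defs.merge u v); split.
      by move=> t tT; rewrite /Defs.merge; case: eqP tT => // ->; rewrite (negPf vT).
    move=> S x y /and3P[xy xS yS].
    have nuv := adj_neq uv; have nxy := adj_neq xy.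
    have mK a : Defs.merge u v (Defs.merge u v a) = Defs.merge u v a.
      by rewrite /Defs.merge; case: (a =P v) => [_|/eqP/negPf->//]; rewrite (negPf nuv).
    (* Only [v] is moved, and the contracted edge joins it to [u]; both are sent to [u], hence lie
       in the preimage of [S]. *)
    have toM a : Defs.merge u v a \in S ->
        connect (adj_in G (Defs.merge u v @^-1: S)) a (Defs.merge u v a).
      move=> aS; case: (a =P v) => [av|av]; last first.
        by rewrite {2}/Defs.merge; case: eqP.
      apply: connect1; rewrite /adj_in !inE mK aS !andbT av.
      by rewrite /Defs.merge eqxx adj_sym.
    move: xy; rewrite /adj EH => /finset.setD1P[_] /imsetP[e eG].
    have /eqP/cards2P[a [b [nab eab]]] := card_edge eG.
    rewrite eab imsetU1 imset_set1 => eq_xy.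
    have abG : adj G a b by rewrite /adj /edge_between -eab.
    (* An edge of the contraction comes from an edge [c d] of [G]: the lifted walk goes from [x] to
       [c], then to [d], then to [y]. *)
    have main c d : adj G c d -> Defs.merge u v c = x -> Defs.merge u v d = y ->
        connect (adj_in G (Defs.merge u v @^-1: S)) x y.
      move=> cd cx dy.
      have cS : Defs.merge u v c \in S by rewrite cx.
      have dS : Defs.merge u v d \in S by rewrite dy.
      apply: (connect_trans (y := c)).
        by rewrite (sym_connect_sym (@adj_in_sym G _)) -cx; apply: toM.
      apply: (connect_trans (y := d)); last by rewrite -dy; apply: toM.
      by apply: connect1; rewrite /adj_in cd !inE cS dS.
    have xM : x \in [set Defs.merge u v a; Defs.merge u v b]%SET by rewrite -eq_xy !inE eqxx.
    have yM : y \in [set Defs.merge u v a; Defs.merge u v b]%SET.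
      by rewrite -eq_xy !inE eqxx orbT.
    move: xM yM; rewrite !inE => /orP[]/eqP ex /orP[]/eqP ey.
    * by rewrite ex ey eqxx in nxy.
    * exact: (main a b).
    * by apply: (main b a) => //; rewrite adj_sym.
    * by rewrite ex ey eqxx in nxy.
- by exists id; split=> // S x y xy; apply: connect1; move: xy; rewrite /adj_in !inE.
- exists (g \o f); split=> [t tT /=|S x y xy]; first by rewrite fT ?gT.
  (* The liftings compose: each edge used in the intermediate graph is replaced by a walk in [G]
     inside the preimage. *)
  have -> : (g \o f) @^-1: S = f @^-1: (g @^-1: S) by apply/setP => z; rewrite !inE.
  exact: connect_sub (fS _) _ _ (gS _ _ _ xy).
Qed.

End Minors.

(** * The square grid and its metric *)

Section Grid.
Variable k : nat.
Local Notation cell := ('I_k.+1 * 'I_k.+1)%type.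
Implicit Types (x y z : cell) (p q : seq cell) (A : {set cell}).

Definition step x y : bool :=
  (y.1 == x.1.+1 :> nat) && (y.2 == x.2 :> nat) ||
  (y.1 == x.1 :> nat) && (y.2 == x.2.+1 :> nat).

Definition grid_edges : {set {set cell}} :=
  [set e | [exists x, exists y, (e == edge_between x y) && step x y]]%SET.

Lemma grid_edgeP e :
  reflect (exists x y, e = edge_between x y /\ step x y) (e \in grid_edges).
Proof.
rewrite inE; apply: (iffP existsP) => [[x /existsP[y /andP[/eqP exy xy]]]|[x [y [exy xy]]]].
  by exists x, y.
by exists x; apply/existsP; exists y; rewrite exy eqxx.
Qed.

Lemma step_neq x y : step x y -> x != y.
Proof. by apply: contraTneq => ->; rewrite /step; lia. Qed.

Lemma grid_edges_wf :
  [forall e in grid_edges, (e \subset [set: cell]%SET) && (#|e| == 2%N)].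
Proof.
apply/forall_inP => e /grid_edgeP[x [y [-> /step_neq xy]]].
by rewrite finset.subsetT cards2 xy.
Qed.

Definition grid : graph cell := Graph grid_edges_wf.

Lemma grid_adj x y : adj grid x y = step x y || step y x.
Proof.
apply/idP/idP => [/grid_edgeP[a [b [/setP eab ab]]]|/orP[xy|yx]].
- have := eab x; have := eab y; have := eab a; have := eab b.
  rewrite !inE !eqxx /= ?orbT => eb ea.
  move=> /esym/orP[/eqP ey|/eqP ey] /esym/orP[/eqP ex|/eqP ex];
    subst; rewrite ?ab ?orbT //; move: ab ea eb; rewrite !eqxx ?orbb ?orbF;
  by move=> /step_neq/negPf; rewrite ?[b == a]eq_sym => ->.
- by apply/grid_edgeP; exists x, y.
- by apply/grid_edgeP; exists y, x; split=> //; rewrite /edge_between finset.setUC.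
Qed.

Definition manhattan x y : nat :=
  ((x.1 - y.1) + (y.1 - x.1) + ((x.2 - y.2) + (y.2 - x.2)))%N.

Lemma manhattan_le_size x p :
  path (adj grid) x p -> (manhattan x (last x p) <= size p)%N.
Proof.
elim: p x => [|y p IH] x /=; first by rewrite /manhattan; lia.
by move=> /andP[+ /IH]; rewrite grid_adj /step /manhattan; lia.
Qed.

Lemma manhattan_walk x y :
  exists p, [/\ path (adj grid) x p, last x p = y & size p = manhattan x y].
Proof.
have [n] := ubnP (manhattan x y); elim: n x => // n IH x xyn.
(* It suffices to find a neighbour one unit closer to [y]; the first coordinate is corrected before
   the second. *)
have closer x' : step x x' || step x' x -> (manhattan x' y).+1 = manhattan x y ->
    exists p, [/\ path (adj grid) x p, last x p = y & size p = manhattan x y].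
  move=> xx' dx'; have [|p [px' lx' sp]] := IH x'; first by lia.
  by exists (x' :: p); rewrite /= grid_adj xx' px' lx' sp dx'.
have := ltn_ord y.1; have := ltn_ord y.2; have := ltn_ord x.1; have := ltn_ord x.2.
move=> x2 x1 y2 y1.
case: (ltngtP x.1 y.1) => [lt|gt|eq1].
- apply: (closer (inord x.1.+1, x.2)); rewrite /step /manhattan /= inordK; lia.
- apply: (closer (inord x.1.-1, x.2)); rewrite /step /manhattan /= inordK; lia.
- case: (ltngtP x.2 y.2) => [lt|gt|eq2].
  + apply: (closer (x.1, inord x.2.+1)); rewrite /step /manhattan /= inordK; lia.
  + apply: (closer (x.1, inord x.2.-1)); rewrite /step /manhattan /= inordK; lia.
  + exists [::]; split=> //=; last by rewrite /manhattan; lia.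
    by case: x y eq1 eq2 {IH xyn closer x1 x2 y1 y2} => [? ?] [? ?] /= /val_inj -> /val_inj ->.
Qed.

Lemma grid_dist (R : realType) x y :
  dist grid (fun=> 1 : R) x y = ((manhattan x y)%:R)%:E.
Proof.
have len z p : path_length (fun=> 1 : R) z p = (size p)%:R.
  elim: p z => [|a p IH] z; first by rewrite /path_length big_nil.
  by rewrite path_length_cons IH -natr1 addrC.
apply/eqP; rewrite eq_le; apply/andP; split.
  have [p [px <- <-]] := manhattan_walk x y.
  by rewrite -(len x); apply: dist_le_walk => // e _; rewrite ler01.
apply: le_ereal_inf_tmp => _ [p [px _ <-] <-].
by rewrite len lee_fin ler_nat manhattan_le_size.
Qed.

(* The parity of the number of times that the walk a :: q, continued upwards
   beyond the top side of the grid, crosses the horizontal ray that starts at z,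
   runs to the right and is shifted up by one half. *)
Fixpoint crossings (z a : cell) (q : seq cell) : bool :=
  ((z.1 <= a.1) &&
     (if q is b :: _ then (z.2 < a.2) (+) (z.2 < b.2) else ~~ (z.2 < a.2)))%N
  (+) (if q is b :: q' then crossings z b q' else false).

(** * Crossing parity, and the intersection of sets joining opposite sides *)

Lemma cell_eq x y : (x == y) = (x.1 == y.1 :> nat) && (x.2 == y.2 :> nat).
Proof. by case: x y => [? ?] [? ?]. Qed.

(** The shortened ray loses only the vertical edge going up from [z], or the upward continuation
    from [z] when [z] is on the top side; a walk avoiding [z] uses neither. *)
Lemma crossings_right z z' a q :
    z'.1 = z.1.+1 :> nat -> z'.2 = z.2 :> nat ->
    z \notin a :: q -> path (adj grid) a q -> (last a q).2 = k :> nat ->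
  crossings z a q = crossings z' a q.
Proof.
move=> z1 z2; elim: q a => [|b q IH] a /=.
  by rewrite inE cell_eq; have := ltn_ord z.2; lia.
rewrite inE negb_or => /andP[za zq] /andP[ab bq] lq.
rewrite -IH //; move: zq; rewrite inE negb_or => /andP[zb _].
move: ab za zb; rewrite grid_adj /step !cell_eq.
by case: (crossings z b q); lia.
Qed.

(** Between the two rays lie the cells of the row of [z'] from [z'] rightwards. A walk avoiding [z']
    enters and leaves this strip only across the rays, and its continuation ends outside, so the
    parities differ exactly when it starts in the strip. *)
Lemma crossings_up z z' a q :
    z'.1 = z.1 :> nat -> z'.2 = z.2.+1 :> nat ->
    z' \notin a :: q -> path (adj grid) a q -> (last a q).2 = k :> nat ->
  crossings z a q =
  crossings z' a q (+) ((z.1 <= a.1) && (a.2 == z'.2 :> nat))%N.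
Proof.
move=> z1 z2; elim: q a => [|b q IH] a /=.
  by rewrite inE cell_eq; have := ltn_ord z.2; lia.
rewrite inE negb_or => /andP[za zq] /andP[ab bq] lq.
rewrite IH //; move: zq; rewrite inE negb_or => /andP[zb _].
move: ab za zb; rewrite grid_adj /step !cell_eq.
by case: (crossings z' b q); lia.
Qed.

(** From the left side the ray spans the whole grid, so the parity tells whether the walk, which
    ends above, starts below the ray. *)
Lemma crossings_left_side z a q :
  z.1 = 0 :> nat -> crossings z a q = ~~ (z.2 < a.2)%N.
Proof.
move=> z1; elim: q a => [|b q IH] a /=; rewrite z1 ?IH; lia.
Qed.

(** From the right side the ray can only be crossed by leaving or entering [z] itself. *)
Lemma crossings_right_side z a q :
    z.1 = k :> nat -> z \notin a :: q -> path (adj grid) a q ->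
    (last a q).2 = k :> nat ->
  crossings z a q = false.
Proof.
move=> z1; elim: q a => [|b q IH] a /=.
  by rewrite inE cell_eq; have := ltn_ord z.2; have := ltn_ord a.1; lia.
rewrite inE negb_or => /andP[za zq] /andP[ab bq] lq.
rewrite IH //; move: zq; rewrite inE negb_or => /andP[zb _].
move: ab za zb; rewrite grid_adj /step !cell_eq.
by have := ltn_ord a.1; have := ltn_ord b.1; lia.
Qed.

(** If the walk missed [A], its crossing parity would be constant along connections inside [A], yet
    it is odd at [x] on the left side and even at [y] on the right side. *)
Lemma grid_crossing A x y (a : cell) q :
    x.1 = 0 :> nat -> y.1 = k :> nat -> x \in A -> connect (adj_in grid A) x y ->
    a.2 = 0 :> nat -> (last a q).2 = k :> nat -> path (adj grid) a q ->
  exists2 z, z \in A & z \in a :: q.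
Proof.
move=> x1 y1 xA xy a2 lq pq.
have [/exists_inP//|/exists_inPn noz] := boolP [exists z in A, z \in a :: q].
have same u v : u \in A -> v \in A -> step u v -> crossings u a q = crossings v a q.
  move=> /noz uq /noz vq /orP[]/andP[/eqP ? /eqP ?]; first exact: crossings_right.
  (* The correction term vanishes: the walk starts at height 0, whereas [v] has positive height. *)
  by rewrite (crossings_up _ _ vq) // a2; lia.
have cl : fingraph.closed (adj_in grid A) [pred z | (z \in A) && crossings z a q].
  move=> u v /and3P[uv uA vA]; rewrite !inE uA vA /=.
  by move: uv; rewrite grid_adj => /orP[] /same ->.
have := closed_connect cl xy; rewrite !inE xA crossings_left_side // a2 /=.
move=> /esym/andP[yA].
by rewrite crossings_right_side // noz.
Qed.

(** * The straight-line drawing of the grid *)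

Section Drawing.
Variable R : realType.

Definition grid_pos x : R * R := (x.1%:R, x.2%:R).

(* The pick orients the edge, so that its arc goes right or up. *)
Definition grid_arc (e : {set cell}) (t : R) : R * R :=
  if [pick xy : cell * cell | (e == edge_between xy.1 xy.2) && step xy.1 xy.2]
    is Some (x, y)
  then (x.1%:R + t * (y.1 - x.1)%:R, x.2%:R + t * (y.2 - x.2)%:R) else (0, 0).

(** The boolean [h] tells horizontal edges from vertical ones, so that one formula covers both. *)
Lemma grid_arcP e : e \in grid_edges -> exists x y (h : bool),
  [/\ e = edge_between x y, y.1 = (x.1 + h)%N :> nat, y.2 = (x.2 + ~~ h)%N :> nat &
      grid_arc e = fun t => (x.1%:R + t * h%:R, x.2%:R + t * (~~ h)%:R)].
Proof.
move=> /grid_edgeP[x0 [y0 [e0 s0]]].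
rewrite /grid_arc; case: pickP => [[x y] /= /andP[/eqP-> sxy]|/(_ (x0, y0))]; last first.
  by rewrite /= e0 eqxx s0.
case/orP: sxy => /andP[/eqP y1 /eqP y2]; [exists x, y, true|exists x, y, false];
  by rewrite y1 y2 subSnn subnn addn1 addn0.
Qed.

Lemma natr_add_frac_neq (a b : nat) (t : R) : t \in `]0, 1[ -> a%:R + t <> b%:R.
Proof.
rewrite in_itv /= => /andP[t0 t1] eab.
have [|] := leqP b a; first by rewrite -(ler_nat R); lra.
by rewrite -(ler_nat R) -natr1; lra.
Qed.

Lemma natr_add_frac_inj (a b : nat) (s t : R) :
  s \in `]0, 1[ -> t \in `]0, 1[ -> a%:R + s = b%:R + t -> a = b.
Proof.
rewrite !in_itv /= => /andP[s0 s1] /andP[t0 t1] eab.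
apply/eqP; rewrite eqn_leq; apply/andP; split;
  by rewrite -ltnS -(ltr_nat R) -natr1; lra.
Qed.

Lemma continuous_segment (a b c d : R) :
  continuous (fun t : R => (a + t * c, b + t * d)).
Proof.
move=> t; apply: (@cvg_pair _ _ _ (nbhs t) (nbhs (a + t * c)) (nbhs (b + t * d)));
  (apply: cvgD; first exact: cvg_cst);
  by apply: cvgM; [exact: cvg_id|exact: cvg_cst].
Qed.

(** An interior point of an arc has exactly one non-integer coordinate. It is therefore no vertex,
    and it determines the direction and the starting cell of its edge. *)
Lemma planar_grid : planar R grid.
Proof.
exists grid_pos, grid_arc; split.
- move=> x y _ _ [] /eqP; rewrite eqr_nat => /eqP ? /eqP; rewrite eqr_nat => /eqP ?.
  by apply/eqP; rewrite cell_eq; apply/andP; split; apply/eqP.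
- move=> e /grid_arcP[x [y [h [-> y1 y2 ->]]]]; split.
  + exact/continuous_subspaceT/continuous_segment.
  + by move=> s t _ _ []; case: (h) => /=; lra.
  + exists x, y; split=> //; rewrite /grid_pos.
      by rewrite !mul0r !addr0.
    by rewrite !mul1r y1 y2 !natrD.
- move=> e z t /grid_arcP[x [y [h [_ _ _ ->]]]] _ t01 [].
  by case: h => /=; rewrite !mulr1 => e1 e2; [move: e1|move: e2]; exact: natr_add_frac_neq.
- move=> e f s t /grid_arcP[x [y [h [-> y1 y2 ->]]]] /grid_arcP[x' [y' [h' [-> y1' y2' ->]]]].
  move=> /eqP nef s01 t01 [e1 e2]; apply: nef.
  have ehh : h = h'.
    by case: h h' e1 e2 {y1 y2 y1' y2'} => [] [] //=; rewrite !mulr0 !addr0 !mulr1;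
      [move=> /natr_add_frac_neq|move=> _ /natr_add_frac_neq]; case.
  have [ex1 ex2] : x.1 = x'.1 :> nat /\ x.2 = x'.2 :> nat.
    subst h'; case: h e1 e2 {y1 y2 y1' y2'} => /=; rewrite !mulr0 !addr0 !mulr1.
      by move=> /(natr_add_frac_inj s01 t01) -> /eqP; rewrite eqr_nat => /eqP.
    by move=> /eqP; rewrite eqr_nat => /eqP -> /(natr_add_frac_inj s01 t01).
  have -> : x = x' by apply/eqP; rewrite cell_eq ex1 ex2 !eqxx.
  have -> // : y = y' by apply/eqP; rewrite cell_eq y1 y2 y1' y2' ex1 ex2 ehh !eqxx.
Qed.

End Drawing.

End Grid.

(** Serves to pad the row and column ends to exactly [k] terminals. *)
Lemma extend_set (V : finType) (S : {set V}) k :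
  (#|S| <= k <= #|V|)%N -> exists2 T : {set V}, S \subset T & #|T| = k.
Proof.
move=> /andP[Sk kV].
have /card_geqP[s [us szs sS]] : (k - #|S| <= #|~: S|)%N by have := cardsC S; lia.
exists (S :|: [set x in s])%SET; first exact: finset.subsetUl.
rewrite cardsU (_ : _ :&: _ = finset.set0)%SET.
  by rewrite cards0 subn0 cardsE (card_uniqP us) szs subnKC.
apply/setP => x; rewrite !inE; apply/negP => /andP[xS /sS].
by rewrite inE xS.
Qed.

Lemma connect_path_set (V : finType) (G : graph V) x p :
  path (adj G) x p -> connect (adj_in G [set z in x :: p]%SET) x (last x p).
Proof.
move=> xp; apply/connectP; exists p => //.
have sub : {in x :: p &, subrel (adj G) (adj_in G [set z in x :: p]%SET)}.
  by move=> a b ap bp ab; apply/and3P; split=> //; rewrite finset.in_set.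
by apply: (sub_in_path (P := mem (x :: p)) sub) xp; apply/allP.
Qed.

Lemma adj_in_path_subset (V : finType) (G : graph V) (S : {set V}) x p :
  x \in S -> path (adj_in G S) x p -> {subset x :: p <= S}.
Proof.
elim: p x => [|y p IH] x xS /=; first by move=> _ z; rewrite inE => /eqP->.
move=> /andP[/and3P[_ _ yS] py] z; rewrite inE => /predU1P[->//|].
exact: IH.
Qed.

(** * Distance-preserving minors of the grid *)

Section GridMinor.
Variables (R : realType) (k n : nat).
Local Notation cell := ('I_k.+1 * 'I_k.+1)%type.
Variables (T : {set cell}) (G' : graph cell) (l' : {set cell} -> R).
Hypothesis n_le : (n <= k.+1)%N.
Hypothesis G'_dp : distance_preserving_minor (grid k) (fun=> 1) T G' l'.
Implicit Types (x y z : cell) (p : seq cell).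

(** A slack of 1 suffices, so the infimum need not be shown to be attained. *)
Lemma short_path x y : x \in T -> y \in T -> manhattan x y = k ->
  exists p, path_from_to G' x y p /\ path_length l' x p < k%:R + 1.
Proof.
case: G'_dp => _ _ dG' xT yT xy.
have : (dist G' l' x y < (k%:R + 1)%:E)%E.
  by rewrite dG' // grid_dist xy lte_fin ltrDl.
by move=> /ereal_inf_lt[_ [p pxy <-]]; rewrite lte_fin; exists p.
Qed.

(** A common vertex would bound the sum of the crosswise distances by less than [2 * k + 2], while
    each of them is at least [k + 1]. *)
Lemma short_paths_disjoint x y x' y' p p' z :
    x \in T -> y \in T -> x' \in T -> y' \in T ->
    path_from_to G' x y p -> path_length l' x p < k%:R + 1 ->
    path_from_to G' x' y' p' -> path_length l' x' p' < k%:R + 1 ->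
    (k < manhattan x y')%N -> (k < manhattan x' y)%N ->
  z \in x :: p -> z \in x' :: p' -> False.
Proof.
case: G'_dp => _ l0 dG' xT yT x'T y'T pxy lp pxy' lp' xy' x'y zp zp'.
have := dist_exchange l0 pxy pxy' zp zp'.
rewrite !dG' // !grid_dist -EFinD lee_fin.
by move: xy' x'y; rewrite -!(ler_nat R) -!natr1; lra.
Qed.

Definition left_end (i : 'I_n) : cell := (ord0, widen_ord n_le i).
Definition right_end (i : 'I_n) : cell := (ord_max, widen_ord n_le i).
Definition bottom_end (j : 'I_n) : cell := (widen_ord n_le j, ord0).
Definition top_end (j : 'I_n) : cell := (widen_ord n_le j, ord_max).

Lemma manhattan_row i i' :
  manhattan (left_end i) (right_end i') = (k + ((i - i') + (i' - i)))%N.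
Proof. by rewrite /manhattan /=; lia. Qed.

Lemma manhattan_column j j' :
  manhattan (bottom_end j) (top_end j') = (k + ((j - j') + (j' - j)))%N.
Proof. by rewrite /manhattan /=; lia. Qed.

Lemma add_diff_gt (i j : 'I_n) : i != j -> (k < k + ((i - j) + (j - i)))%N.
Proof. by rewrite -val_eqE /=; lia. Qed.

Hypothesis ends_T :
  forall i, [/\ left_end i \in T, right_end i \in T, bottom_end i \in T & top_end i \in T].
Hypothesis TG' : T \subset vertices G'.

Lemma grid_minor_size : (n ^ 2 <= #|vertices G'|)%N.
Proof.
have [G'min _ _] := G'_dp.
have [f [fT fS]] := minor_lift G'min.
have /choice[rowp rowP] : forall i : 'I_n, exists p,
    path_from_to G' (left_end i) (right_end i) p /\
    path_length l' (left_end i) p < k%:R + 1.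
  move=> i; have [lT rT _ _] := ends_T i.
  by apply: short_path => //; rewrite manhattan_row subnn !addn0.
have /choice[colp colP] : forall j : 'I_n, exists p,
    path_from_to G' (bottom_end j) (top_end j) p /\
    path_length l' (bottom_end j) p < k%:R + 1.
  move=> j; have [_ _ bT tT] := ends_T j.
  by apply: short_path => //; rewrite manhattan_column subnn !addn0.
have fconn x y p : path_from_to G' x y p ->
    connect (adj_in (grid k) (f @^-1: [set z in x :: p]%SET)) x y.
  by move=> [/connect_path_set xp _ <-]; apply: connect_sub (fS _) _ _ xp.
have meet (ij : 'I_n * 'I_n) : exists z,
    z \in left_end ij.1 :: rowp ij.1 /\ z \in bottom_end ij.2 :: colp ij.2.
  case: ij => i j /=.
  have [lT rT _ _] := ends_T i; have [_ _ bT tT] := ends_T j.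
  have [rp _] := rowP i; have [cp _] := colP j.
  have /connectP[q q_path q_last] := fconn _ _ _ cp.
  have bQ : bottom_end j \in f @^-1: [set z in bottom_end j :: colp j]%SET.
    by rewrite !inE fT ?eqxx.
  have [||||||z] := grid_crossing (a := bottom_end j) (q := q) _ _ _ (fconn _ _ _ rp).
  - by [].
  - by [].
  - by rewrite !inE fT ?eqxx.
  - by [].
  - by rewrite -q_last.
  - by apply: sub_path q_path => a b /and3P[].
  rewrite 2!inE => zr /(adj_in_path_subset bQ q_path); rewrite 2!inE => zc.
  (* The crossing cell [z] lies in the grid; its image under [f] is the common vertex of the two
     paths in the minor. *)
  by exists (f z).
have [m mP] := choice meet.
(* A vertex lies on at most one row path and at most one column path, so it determines both
   indices. *)
have minj : injective m.
  move=> [i j] [i' j'] mm; have /= [mr mc] := mP (i, j).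
  have /= [] := mP (i', j'); rewrite -mm => mr' mc'.
  have [lT rT bT tT] := ends_T i; have [lT' rT' bT' tT'] := ends_T i'.
  have [jlT jrT jbT jtT] := ends_T j; have [jlT' jrT' jbT' jtT'] := ends_T j'.
  have [rp rl] := rowP i; have [rp' rl'] := rowP i'.
  have [cp cl] := colP j; have [cp' cl'] := colP j'.
  congr (_, _); apply: contrapT => /eqP neq.
    apply: (short_paths_disjoint lT rT lT' rT' rp rl rp' rl' _ _ mr mr');
    by rewrite manhattan_row add_diff_gt // eq_sym.
  apply: (short_paths_disjoint jbT jtT jbT' jtT' cp cl cp' cl' _ _ mc mc');
  by rewrite manhattan_column add_diff_gt // eq_sym.
rewrite -{1}[n]card_ord -mulnn -card_prod -(card_imset _ minj).
apply/subset_leq_card/fintype.subsetP => _ /imsetP[[i j] _ ->].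
have /= [mr _] := mP (i, j); have [[rp _ _] _] := rowP i; have [lT _ _ _] := ends_T i.
by apply: (path_vertices _ rp) mr; exact: (fintype.subsetP TG').
Qed.

End GridMinor.

(** Each index accounts for four terminals, whence the division by 4. The linear bound, from the
    survival of terminals, covers [k < 4], where the quadratic one is void. *)
Lemma vertices_suffice_planar_lb (R : realType) k n :
  vertices_suffice R (planar R) k n -> ((k %/ 4) ^ 2 <= n)%N /\ (k <= n)%N.
Proof.
move=> suff; set m := (k %/ 4)%N.
have m_le : (m <= k.+1)%N by rewrite /m; lia.
pose S := (left_end m_le @: [set: 'I_m] :|: right_end m_le @: [set: 'I_m] :|:
  (bottom_end m_le @: [set: 'I_m] :|: top_end m_le @: [set: 'I_m]))%SET.
have Sk : (#|S| <= k)%N.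
  have im_le (g : 'I_m -> 'I_k.+1 * 'I_k.+1) : (#|g @: [set: 'I_m]%SET| <= m)%N.
    by rewrite (leq_trans (leq_imset_card _ _)) // cardsT card_ord.
  have Um (A B : {set 'I_k.+1 * 'I_k.+1}) a b :
      (#|A| <= a -> #|B| <= b -> #|A :|: B| <= a + b)%N.
    by move=> Aa Bb; rewrite (leq_trans (leq_card_setU _ _)) ?leq_add.
  by apply: leq_trans (Um _ _ _ _ (Um _ _ _ _ (im_le _) (im_le _))
    (Um _ _ _ _ (im_le _) (im_le _))) _; rewrite /m; lia.
have [T ST Tk] : exists2 T : {set 'I_k.+1 * 'I_k.+1}, S \subset T & #|T| = k.
  by apply: extend_set; rewrite Sk card_prod card_ord; nia.
have [G' [l' [G'P G'n]]] : exists G' l',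
    distance_preserving_minor (grid k) (fun=> 1 : R) T G' l' /\ (#|vertices G'| <= n)%N.
  apply: suff => //; [exact: planar_grid|exact: finset.subsetT].
have TG' : T \subset vertices G'.
  by case: (G'P) => /minor_terminals + _ _; apply; exact: finset.subsetT.
split; last by rewrite -Tk (leq_trans _ G'n) // subset_leq_card.
apply: leq_trans G'n; apply: (grid_minor_size (n_le := m_le) G'P) => // i.
by split; apply: (fintype.subsetP ST); rewrite !inE imset_f ?orbT.
Qed.

Theorem theorem1 (R : realType) :
  exists c : R, 0 < c /\
    forall k : nat, (0 < k)%N ->
      (fstar R (planar R) k <= fstar R all_graphs k)%E /\
      ((c * k%:R ^+ 2)%:E <= fstar R (planar R) k)%E.
Proof.
(* With [m = k %/ 4] positive, [k <= 4 * m + 3 <= 7 * m], so [k ^ 2 <= 49 * m ^ 2]. *)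
exists 49%:R^-1; split=> [|k k0]; first by rewrite invr_gt0.
split.
  (* A bound valid for all graphs is valid for planar ones, so the planar infimum is over a larger
     set. *)
  apply: le_ereal_inf => _ [n nP <-]; exists n => // V G l T _; exact: nP.
apply: le_ereal_inf_tmp => _ [n /vertices_suffice_planar_lb[mn kn] <-].
rewrite lee_fin ler_pdivrMl // -natrX -natrM ler_nat.
have [k4|k4] := ltnP k 4; first by nia.
by have := divn_eq k 4; have := ltn_pmod k (isT : 0 < 4)%N; move: mn; nia.
Qed.
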